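(* Let $T$ be a plane labelled bipartite tree with $n$ white and $m$ black vertices, where $n+m$ is even. Let $T^*$ be obtained from $T$ by an elementary movement. Then $T^*$ and $T$ have opposite parities, i.e. $i(T^* )\ne i(T)$.
   Context: A plane labelled bipartite tree with $n$ white and $m$ black vertices is defined as follows. It is a finite tree embedded in the oriented plane, considered up to orientation-preserving homeomorphism. Its vertices are colored white and black so that adjacent vertices have different colors. The white vertices carry the distinct labels $v_1,\dots,v_n$ and the black vertices the distinct labels $u_1,\dots,u_m$. String $c(T)$: choose a white vertex $v_i$ (root vertex) and an edge $e$ incident to it (root edge). Walk counterclockwise around $T$ (contour walk keeping the tree on the left), starting at $v_i$ along $e$, until returning to $v_i$ after traversing every edge twice. Write a vertex's label when it is met for the first time, and a closing bracket '')'' when it is met for the last time. Invariant: let - $a$ be the number of pairs of white labels with $v_k$ before $v_l$ in $c(T)$ and $k>l$; - $b$ be the analogous number of inversions among black labels; - $c$ be the number of pairs (black label, white label) with the black label before the white one; - $d$ be the number of pairs (closing bracket, label) with the bracket before the label; - $e_0=|n-m|/2$. Then $i(T)\equiv a+b+c+\tfrac{d+e_0}{2}\pmod 2$, with $i(T)\in\{0,1\}$. This value does not depend on the choice of root vertex and root edge. $T$ is even if $i(T)=0$ and odd otherwise. Movements: a leaf is a vertex $A$ of degree one together with its incident edge. Let $A$ be a leaf of $T$ attached to the vertex $B$ (of the opposite color to $A$). Remove $A$ and its edge, obtaining a plane tree $T'$; the former position of the edge determines a corner (angle between consecutive edges) of $T'$ at $B$. A movement moves $A$ along the contour of $T'$,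 clockwise or counterclockwise, and reattaches it (with its label) at a corner of some vertex $C$ of the same color as $B$; possibly $C=B$. The movement bypasses the vertices at the corners of $A$'s color passed along the way, counted with multiplicity: a vertex passed at two different corners counts twice. An elementary movement is one in which the leaf bypasses exactly one vertex of its own color. Equivalently, the leaf is reattached at the nearest corner of a vertex of $B$'s color along the contour of $T'$, in one of the two directions. *)

(* Defs.v *)
From mathcomp Require Import all_boot.
Set Implicit Arguments. Unset Strict Implicit. Unset Printing Implicit Defensive.

(* Vertices of a labelled bipartite tree with n white and m black vertices:
   inl k is the white vertex v_{k+1}, inr k is the black vertex u_{k+1}. *)
Definition V (n m : nat) : finType := ('I_n + 'I_m)%type.

Definition white {n m} (x : V n m) : bool := if x is inl _ then true else false.

(* A plane tree on the vertex set V n m is given by its rotation system: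
   rs x lists the neighbours of x in counterclockwise order around x
   (considered up to cyclic rotation). *)
Definition adj {n m} (rs : V n m -> seq (V n m)) : rel (V n m) :=
  fun x y => y \in rs x.

Definition is_plane_tree {n m} (rs : V n m -> seq (V n m)) : Prop :=
  [/\ forall x, uniq (rs x),
      forall x y, (y \in rs x) = (x \in rs y),
      forall x y, y \in rs x -> white x != white y,
      forall x y, connect (adj rs) x y
    & \sum_(x : V n m) size (rs x) = (n + m - 1).*2 ].

(* one step of the counterclockwise contour walk (tree kept on the left):
   having traversed the directed edge (x -> y), continue along the edge
   from y to the counterclockwise successor of x around y. *)
Definition cstep {n m} (rs : V n m -> seq (V n m)) (p : V n m * V n m) :=
  (p.2, next (rs p.2) p.1).

(* sequence of vertices met along the contour walk starting at root vertex r
   along root edge (r, e); it has 2(n+m-1)+1 entries, ending back at r. *)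
Definition contour {n m} (rs : V n m -> seq (V n m)) (r e : V n m) : seq (V n m) :=
  [seq (iter k (cstep rs) (r, e)).1 | k <- iota 0 (n + m - 1).*2.+1].

(* The string c(T): Some x = label of x, None = closing bracket ")".
   At a position where a vertex is met both for the first and the last time
   (a leaf), its label is written before its bracket. *)
Definition cstring {n m} (rs : V n m -> seq (V n m)) (r e : V n m)
  : seq (option (V n m)) :=
  let vs := contour rs r e in
  flatten [seq let x := nth r vs j in
               (if index x vs == j then [:: Some x] else [::]) ++
               (if j == (size vs).-1 - index x (rev vs) then [:: None] else [::])
          | j <- iota 0 (size vs)].

Fixpoint npairs {T : Type} (P : T -> T -> bool) (s : seq T) : nat :=
  match s with
  | [::] => 0
  | x :: s' => count (P x) s' + npairs P s'
  end.

Definition Pa {n m} (x y : option (V n m)) : bool :=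
  match x, y with Some (inl k), Some (inl l) => l < k | _, _ => false end.
Definition Pb {n m} (x y : option (V n m)) : bool :=
  match x, y with Some (inr k), Some (inr l) => l < k | _, _ => false end.
Definition Pc {n m} (x y : option (V n m)) : bool :=
  match x, y with Some (inr _), Some (inl _) => true | _, _ => false end.
Definition Pd {n m} (x y : option (V n m)) : bool :=
  match x, y with None, Some _ => true | _, _ => false end.

Definition e0 (n m : nat) : nat := ((n - m) + (m - n))./2.

Definition iT {n m} (rs : V n m -> seq (V n m)) (r e : V n m) : bool :=
  let s := cstring rs r e in
  odd (npairs Pa s + npairs Pb s + npairs Pc s + (npairs Pd s + e0 n m)./2).

Definition valid_root {n m} (rs : V n m -> seq (V n m)) (r e : V n m) : bool :=
  white r && (e \in rs r).

Definition insert_after {T : eqType} (s a : T) (c : seq T) : seq T :=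
  let i := index s c in take i.+1 c ++ a :: drop i.+1 c.
Definition insert_before {T : eqType} (p a : T) (c : seq T) : seq T :=
  let i := index p c in take i c ++ a :: drop i c.

(* rotation system after removing the leaf A (attached to B = its unique
   neighbour); the entry of A itself is irrelevant and overwritten below. *)
Definition remove_leaf {n m} (rs : V n m -> seq (V n m)) (A : V n m) :=
  let B := head A (rs A) in
  fun x => if x == B then rem A (rs B) else rs x.

(* Counterclockwise elementary movement of the leaf A: in T' the corner at B
   left by A lies between p = prev and s = next of A around B; walking
   counterclockwise along the contour of T' one passes s (the single bypassed
   vertex of A's colour) and reaches the corner of C = next of B around s,
   i.e. the corner right after s around C. *)
Definition move_ccw {n m} (rs : V n m -> seq (V n m)) (A : V n m) :=
  let B := head A (rs A) in
  let s := next (rs B) A in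
  let C := next (rs s) B in
  fun x => if x == A then [:: C]
           else if x == C then insert_after s A (remove_leaf rs A C)
           else remove_leaf rs A x.

(* Clockwise elementary movement: bypass p, reach the corner of
   C = prev of B around p lying right before p around C. *)
Definition move_cw {n m} (rs : V n m -> seq (V n m)) (A : V n m) :=
  let B := head A (rs A) in
  let p := prev (rs B) A in
  let C := prev (rs p) B in
  fun x => if x == A then [:: C]
           else if x == C then insert_before p A (remove_leaf rs A C)
           else remove_leaf rs A x.

(* rs' is (a rotation system of) a tree obtained from rs by an elementary
   movement of some leaf A.  The movement needs B to have another edge
   (otherwise T' has no vertex of A's colour to bypass). *)
Definition elementary_move {n m} (rs rs' : V n m -> seq (V n m)) : Prop :=
  exists A : V n m,
    [/\ size (rs A) = 1,
        1 < size (rs (head A (rs A)))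
      & (forall x, exists k, rs' x = rot k (move_ccw rs A x)) \/
        (forall x, exists k, rs' x = rot k (move_cw rs A x)) ].

(* Main.v *)
Require Import Defs.
From mathcomp Require Import all_boot zify.
Set Implicit Arguments. Unset Strict Implicit. Unset Printing Implicit Defensive.

(** Rooting the tree at any vertex, whatever its colour, [a + b + c] counts the
    inversions of the preorder word and [d] the pairs (x, y) with the last visit
    of x before the first visit of y. Moving the root one step along the contour
    walk, across an edge whose far side has K vertices, changes the number of
    inversions by K modulo 2 and d by 2K - N, with N = n + m; so the parity
    changes by N/2, a constant, and it depends only on the colour of the root.
    For an elementary movement of the leaf A from B past s to C, root both trees
    at B: the contour words are B A B s t and B s C A t. If C = B this swaps A
    and s; otherwise A jumps over two vertices and d drops by 2. Either way the
    parity flips. *)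

(** * Counting pairs in the string *)

(** The position of the last occurrence, in the exact form of the bracket test of [cstring], so that
    it folds there. *)
Definition lastpos {T : eqType} (w : seq T) (x : T) : nat :=
  (size w).-1 - index x (rev w).

Definition cross {T : Type} (P : T -> T -> bool) (s t : seq T) : nat :=
  sumn [seq count (P x) t | x <- s].

Lemma npairs_cat (T : Type) (P : T -> T -> bool) (s t : seq T) :
  npairs P (s ++ t) = npairs P s + npairs P t + cross P s t.
Proof.
by rewrite /cross; elim: s => [|x s IHs] /=; rewrite ?addn0 // IHs count_cat; lia.
Qed.

Lemma cross_flatten (T : Type) (P : T -> T -> bool) (g : nat -> seq T) s (r : seq nat) :
  cross P s (flatten [seq g j | j <- r]) = \sum_(j <- r) cross P s (g j).
Proof.
elim: r => [|j r IHr] /=; rewrite ?big_nil ?big_cons -?IHr /cross.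
  by elim: s.
by elim: s {IHr} => [|x s IHs] //=; rewrite count_cat; move: IHs; lia.
Qed.

(** Only pairs from distinct blocks count. The factor [i < j] turns the triangular sum into a square
    one, whose two indices can then be replaced by vertices independently. *)
Lemma npairs_flatten (T : Type) (P : T -> T -> bool) (g : nat -> seq T) a k :
  (forall j, npairs P (g j) = 0) ->
  npairs P (flatten [seq g j | j <- iota a k]) =
  \sum_(a <= i < a + k) \sum_(a <= j < a + k) (i < j) * cross P (g i) (g j).
Proof.
move=> g0; elim: k a => [|k IHk] a /=; first by rewrite addn0 big_geq.
rewrite npairs_cat g0 IHk cross_flatten add0n addSnnS.
rewrite [RHS]big_ltn ?addnS ?ltnS ?leq_addr // addnC; congr (_ + _).
  rewrite big_ltn ?ltnS ?leq_addr // ltnn mul0n add0n.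
  rewrite /index_iota subSS addnC addnK; apply: eq_big_seq => j.
  by rewrite mem_iota => /andP[-> _]; rewrite mul1n.
apply: eq_big_nat => i /andP[lt_ai _].
by rewrite [RHS]big_ltn ?ltnS ?leq_addr // ltnNge ltnW //= mul0n.
Qed.

(** The map [p] is injective with left inverse [nth x0 w], and the indicator keeps exactly its
    image. It is used with [p] the first or the last position. *)
Lemma big_positions (T : finType) (w : seq T) (x0 : T) (p : T -> nat) (F : nat -> nat) :
  (forall x, p x < size w) -> (forall x, nth x0 w (p x) = x) ->
  \sum_(0 <= i < size w) (p (nth x0 w i) == i) * F i = \sum_x F (p x).
Proof.
move=> ltp nthp; rewrite big_mkord.
rewrite (eq_bigr (fun i : 'I_(size w) => if p (nth x0 w i) == i then F i else 0));
  last by move=> i _; case: ifP; rewrite ?mul1n ?mul0n.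
rewrite -big_mkcond /=.
rewrite (reindex_onto (fun x => Ordinal (ltp x)) (fun i : 'I_(size w) => nth x0 w i)).
  by apply: eq_bigl => x /=; rewrite nthp !eqxx.
by move=> i /= /eqP pi; apply: val_inj.
Qed.

Section LastPosition.
Variable T : eqType.
Implicit Types (w s t : seq T) (x : T).

Lemma lastpos_lt w x : x \in w -> lastpos w x < size w.
Proof. by rewrite /lastpos; case: w => //= y w _; lia. Qed.

Lemma nth_lastpos w x0 x : x \in w -> nth x0 w (lastpos w x) = x.
Proof.
move=> xw; have xr : x \in rev w by rewrite mem_rev.
have := nth_index x0 xr; rewrite nth_rev; last by rewrite -(size_rev w) index_mem.
by rewrite /lastpos subnS; congr (nth _ _ _ = _); lia.
Qed.

Lemma lastpos_cat s t x : x \in s ++ t ->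
  lastpos (s ++ t) x = if x \in t then size s + lastpos t x else lastpos s x.
Proof.
rewrite /lastpos rev_cat index_cat mem_rev size_cat mem_cat; case: ifP => [xt _|_].
  by have := index_mem x (rev t); rewrite mem_rev xt size_rev; case: (t) xt => //=; lia.
by rewrite orbF size_rev; case: (s) => //=; lia.
Qed.

Lemma lastpos_cons y w x : x \in w -> lastpos (y :: w) x = (lastpos w x).+1.
Proof. by move=> xw; rewrite -cat1s lastpos_cat ?mem_cat xw ?orbT. Qed.

Lemma lastpos_rcons_id w x : lastpos (rcons w x) x = size w.
Proof. by rewrite /lastpos rev_rcons /= eqxx size_rcons subn0. Qed.

Lemma lastpos_rcons w y x : x != y -> lastpos (rcons w y) x = lastpos w x.
Proof.
by rewrite /lastpos rev_rcons /= size_rcons eq_sym => /negPf->; case: (size w) => /=; lia.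
Qed.

Lemma lastpos_ge_index w x : x \in w -> index x w <= lastpos w x.
Proof.
move=> xw; rewrite leqNgt; apply/negP => /(before_find x).
by rewrite /= nth_lastpos // eqxx.
Qed.

End LastPosition.

(** * From the string to the contour word *)

Section WordParity.
Variables n m : nat.
Implicit Types (x y r e A B C s : V n m) (w t : seq (V n m)).

(** The strict order placing every white label below every black one; it merges a, b and c into one
    inversion count. *)
Definition label_gt x y : bool :=
  match x, y with
  | inl k, inl l => l < k
  | inr k, inr l => l < k
  | inr _, inl _ => true
  | inl _, inr _ => false
  end.

Definition word_inv w : nat :=
  \sum_x \sum_y (index x w < index y w) * label_gt x y.
Definition word_sep w : nat := \sum_x \sum_y (lastpos w x < index y w).
Definition word_parity w : bool := odd (word_inv w + (word_sep w + e0 n m)./2).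

Lemma label_gt_total x y : x != y -> label_gt x y + label_gt y x = 1.
Proof.
case: x y => [i|i] [j|j] //= neq_ij;
by case: ltngtP => // /val_inj eq_ij; rewrite eq_ij eqxx in neq_ij.
Qed.

(** The letters that [cstring] writes at position j. *)
Definition block w (x0 : V n m) (j : nat) : seq (option (V n m)) :=
  let x := nth x0 w j in
  (if index x w == j then [:: Some x] else [::]) ++
  (if j == (size w).-1 - index x (rev w) then [:: None] else [::]).

Definition label_pair (a b : option (V n m)) : bool :=
  match a, b with Some x, Some y => label_gt x y | _, _ => false end.

Lemma npairs_label (s : seq (option (V n m))) :
  npairs Pa s + npairs Pb s + npairs Pc s = npairs label_pair s.
Proof.
elim: s => //= a s <-.
suff -> : count (label_pair a) s = count (Pa a) s + count (Pb a) s + count (Pc a) s.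
  by rewrite (addnACA (count (Pa a) s)) addnACA.
elim: s => //= b s ->.
by case: a b => [[i|i]|] [[j|j]|] /=; lia.
Qed.

(** A block holds at most a label followed by a bracket, and the hypothesis on [P] excludes that
    pair, so nothing is counted inside a block. *)
Lemma npairs_block (P : option (V n m) -> option (V n m) -> bool) w x0 :
  (forall x, ~~ P (Some x) None) ->
  npairs P (flatten [seq block w x0 j | j <- iota 0 (size w)]) =
  \sum_(0 <= i < size w) \sum_(0 <= j < size w)
     (i < j) * cross P (block w x0 i) (block w x0 j).
Proof.
move=> P0; rewrite npairs_flatten // => j.
by rewrite /block; do 2!case: ifP => _ //=; rewrite (negPf (P0 _)).
Qed.

Variables (w : seq (V n m)) (x0 : V n m).
Hypothesis full_w : forall x, x \in w.

Let lt_index x : index x w < size w. Proof. by rewrite index_mem. Qed.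
Let lt_lastpos x : lastpos w x < size w. Proof. exact: lastpos_lt. Qed.

Lemma npairs_label_block :
  npairs label_pair (flatten [seq block w x0 j | j <- iota 0 (size w)]) = word_inv w.
Proof.
rewrite npairs_block //.
pose F i j := (i < j) * label_gt (nth x0 w i) (nth x0 w j).
(* A label is written at i exactly when i is the first position of its vertex; this indicator allows
   [big_positions] for both sums. *)
rewrite (eq_bigr (fun i => (index (nth x0 w i) w == i) * \sum_y F i (index y w))).
  rewrite (@big_positions _ w x0 (fun x => index x w) (fun i => \sum_y F i (index y w))) //.
    apply: eq_bigr => x _; apply: eq_bigr => y _.
    by rewrite /F !nth_index.
  by move=> x; rewrite nth_index.
move=> i _; rewrite -(@big_positions _ w x0 (fun x => index x w)) //; last first.
  by move=> x; rewrite nth_index.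
rewrite big_distrr; apply: eq_bigr => j _ /=.
by rewrite /block /cross /F; do !case: eqP => _ /=; lia.
Qed.

Lemma npairs_sep_block :
  npairs Pd (flatten [seq block w x0 j | j <- iota 0 (size w)]) = word_sep w.
Proof.
rewrite npairs_block //.
pose F i j : nat := i < j.
(* Brackets sit at last positions and labels at first positions, hence [lastpos] outside and [index]
   inside. *)
rewrite (eq_bigr (fun i => (lastpos w (nth x0 w i) == i) * \sum_y F i (index y w))).
  rewrite (@big_positions _ w x0 (lastpos w) (fun i => \sum_y F i (index y w))) //.
  by move=> x; rewrite nth_lastpos.
move=> i _; rewrite -(@big_positions _ w x0 (fun x => index x w)) //; last first.
  by move=> x; rewrite nth_index.
rewrite big_distrr; apply: eq_bigr => j _ /=.
rewrite /block /cross /F -/(lastpos w _) -/(lastpos w _) (eq_sym i).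
by do !case: eqP => _ /=; lia.
Qed.

End WordParity.

Lemma iT_word_parity n m (rs : V n m -> seq (V n m)) r e :
  (forall x, x \in contour rs r e) -> iT rs r e = word_parity (contour rs r e).
Proof.
move=> full_w; rewrite /iT npairs_label /cstring.
by rewrite -/(block _ _) (npairs_label_block r full_w) (npairs_sep_block r full_w).
Qed.

(** * Word surgeries and parity *)

Lemma odd_jump1 a b c : odd (a + 1) = odd b -> odd (b + c) != odd (a + c).
Proof. lia. Qed.

Lemma odd_jump2 a b c : odd (a + 2) = odd b -> odd (b + (c + 2)./2) != odd (a + c./2).
Proof. lia. Qed.

Section Surgery.
Variables n m : nat.
Implicit Types (x y r e a A B C s : V n m) (w t : seq (V n m)).

(* [a] jumps over the vertices of [Y] in the order of first occurrences. *)
Lemma word_inv_jump w w' a (Y : {set V n m}) :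
  a \notin Y ->
  (forall x y, (index x w' < index y w') + (x == a) * (y \in Y) =
               (index x w < index y w) + (y == a) * (x \in Y)) ->
  odd (word_inv w' + #|Y|) = odd (word_inv w).
Proof.
move=> aY jump.
have E : word_inv w' + \sum_(y in Y) label_gt a y = word_inv w + \sum_(y in Y) label_gt y a.
  have -> : \sum_(y in Y) label_gt a y = \sum_x \sum_y (x == a) * (y \in Y) * label_gt x y.
    rewrite [RHS](bigD1 a) //= [X in _ + X]big1 ?addn0 => [|x /negPf->]; last by rewrite big1.
    by rewrite big_mkcond; apply: eq_bigr => y _; rewrite eqxx; case: ifP; lia.
  have -> : \sum_(x in Y) label_gt x a = \sum_x \sum_y (y == a) * (x \in Y) * label_gt x y.
    rewrite big_mkcond; apply: eq_bigr => x _.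
    rewrite [RHS](bigD1 a) //= [X in _ + X]big1 ?addn0 => [|y /negPf->] //.
    by rewrite eqxx; case: ifP; lia.
  rewrite /word_inv -!big_split /=; apply: eq_bigr => x _.
  rewrite -!big_split /=; apply: eq_bigr => y _.
  by rewrite -!mulnDl jump.
(* Each y in Y forms an inversion with a in exactly one of the two orders. The two corrections thus
   add up to the size of Y, and their difference has the same parity. *)
have cardY : \sum_(y in Y) label_gt a y + \sum_(y in Y) label_gt y a = #|Y|.
  rewrite -big_split -sum1_card; apply: eq_bigr => y yY.
  by apply: label_gt_total; apply: contraNneq aY => ->.
by lia.
Qed.

(* [X] is the vertex set of the branch beyond the root edge. *)
Lemma word_parity_shift r e t1 t2 (X : {set V n m}) :
  let w := r :: e :: t1 ++ r :: t2 in
  let w' := rcons (e :: t1 ++ r :: t2) e in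
  ~~ odd (n + m) ->
  (forall x, x \in w) -> last r t2 = r -> last e t1 = e ->
  {subset e :: t1 <= X} -> {subset r :: t2 <= [predC X]} ->
  word_parity w' = word_parity w (+) odd (n + m)./2.
Proof.
move=> w w' evN full_w lastr laste sX sXC.
set k := size t1.
have rX : r \notin X by apply: sXC; rewrite mem_head.
have eX : e \in X by apply: sX; rewrite mem_head.
have neq_re : r != e by apply: contraNneq rX => ->.
have memX x : x \in X -> x \in e :: t1.
  move=> xX; have := full_w x; rewrite inE => /orP[/eqP xr|].
    by rewrite -xr xX in rX.
  by rewrite -cat_cons mem_cat => /orP[] // /sXC; rewrite !inE xX.
have memXC x : x \notin X -> x \in r :: t2.
  move=> xX; have := full_w x; rewrite inE => /orP[/eqP->|]; first exact: mem_head.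
  by rewrite -cat_cons mem_cat => /orP[] // /sX xX'; rewrite xX' in xX.
have notinX x : x \notin X -> (x \in e :: t1) = false by move=> xX; apply: contraNF xX => /sX.
have notinXC x : x \in X -> (x \in r :: t2) = false.
  by move=> xX; apply/negP => /sXC; rewrite !inE xX.
have memu x : x \in e :: t1 ++ r :: t2.
  by rewrite -cat_cons mem_cat; case: (boolP (x \in X)) => [/memX->|/memXC->]; rewrite ?orbT.
set u := e :: t1 ++ r :: t2 in memu w w' full_w *.
have szu : size u = k.+1 + (size t2).+1 by rewrite /u /= size_cat.
(* With w = r :: u and w' = rcons u e, all first and last positions are expressed through u, where X
   fills the positions 0 to k and its complement the rest. *)
have iw x : index x w = if x == r then 0 else (index x u).+1 by rewrite /w /= eq_sym.
have iw' x : index x w' = index x u by rewrite /w' -cats1 index_cat memu.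
have iuX x : x \in X -> index x u <= k.
  by move=> /memX xt; rewrite /u -cat_cons index_cat xt -ltnS -[k.+1]/(size (e :: t1)) index_mem.
have iuXC x : x \notin X -> index x u = k.+1 + index x (r :: t2).
  by move=> /notinX xt; rewrite /u -cat_cons index_cat xt.
have iur : index r u = k.+1 by rewrite iuXC //= eqxx addn0.
have luX x : x \in X -> lastpos u x = lastpos (e :: t1) x.
  by move=> xX; rewrite /u -cat_cons lastpos_cat ?notinXC // -?cat_cons ?memu.
have luX_le x : x \in X -> lastpos u x <= k.
  by move=> xX; rewrite luX // -ltnS -[k.+1]/(size (e :: t1)) lastpos_lt ?memX.
have lue : lastpos u e = k.
  rewrite luX // lastI laste lastpos_rcons_id size_belast //.
have lur : lastpos u r = (size u).-1.
  rewrite /u -cat_cons (lastI r t2) lastr -rcons_cat lastpos_rcons_id size_rcons //.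
have lw x : lastpos w x = (lastpos u x).+1 by rewrite lastpos_cons.
have lw' x : lastpos w' x = if x == e then size u else lastpos u x.
  by have [->|?] := eqVneq x e; rewrite /w' ?lastpos_rcons_id ?lastpos_rcons.
have ltu x : index x u < size u by rewrite index_mem.
clearbody w w' u.
(* The root r heads w, but in w' it first appears after all of X: it jumps over X. *)
have inv : odd (word_inv w' + #|X|) = odd (word_inv w).
  apply: (word_inv_jump rX) => x y; rewrite !iw' !iw.
  have [->|neq_xr] := eqVneq x r; have [->|neq_yr] := eqVneq y r; rewrite ?(negPf rX) ?iur ?ltnn //.
  - case: (boolP (y \in X)) => yX; first by have := iuX y yX; lia.
    rewrite iuXC //= eq_sym (negPf neq_yr); lia.
  - case: (boolP (x \in X)) => xX; first by have := iuX x xX; lia.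
    rewrite iuXC //=; lia.
have sep : word_sep w' + (n + m) = word_sep w + #|X|.*2.
  (* The last visit of e moves to the end, which loses the pairs (e, y) with y outside X and y != r.
     The first visit of r moves behind X, which gains the pairs (x, r) with x in X and x != e. *)
  have : word_sep w' + \sum_x \sum_y ((x == e) * ((y \notin X) && (y != r))) =
         word_sep w + \sum_x \sum_y ((y == r) * ((x \in X) && (x != e))).
    rewrite /word_sep -!big_split; apply: eq_bigr => x _ /=.
    rewrite -!big_split; apply: eq_bigr => y _ /=.
    rewrite iw' iw lw' lw.
    have [->|neq_xe] := eqVneq x e.
      have [->|neq_yr] := eqVneq y r; first by rewrite eX; have := ltu r; lia.
      rewrite lue; case: (boolP (y \in X)) => yX; first by have := iuX _ yX; have := ltu y; lia.
      rewrite iuXC //= eq_sym (negPf neq_yr); have := ltu y; rewrite iuXC //= eq_sym (negPf neq_yr); lia.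
    have [->|neq_yr] := eqVneq y r.
      rewrite iur; case: (boolP (x \in X)) => xX; first by have := luX_le _ xX; lia.
      have := lastpos_ge_index (memu x); rewrite (iuXC x xX); lia.
    rewrite !ltnS /=; lia.
  have cardX : #|X| + #|~: X| = n + m by rewrite cardsC card_sum !card_ord.
  have -> : \sum_x \sum_y ((x == e) * ((y \notin X) && (y != r))) = #|~: X|.-1.
    rewrite (bigD1 e) //= [X in _ + X]big1 ?addn0 => [|x /negPf->]; last by rewrite big1.
    rewrite (cardsD1 r (~: X)) inE rX add1n /= -sum1_card [RHS]big_mkcond; apply: eq_bigr => y _.
    by rewrite !inE eqxx andbC; case: ifP => _; lia.
  have -> : \sum_x \sum_y ((y == r) * ((x \in X) && (x != e))) = #|X|.-1.
    rewrite (cardsD1 e X) eX add1n /= -sum1_card [RHS]big_mkcond; apply: eq_bigr => x _ /=.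
    rewrite (bigD1 r) //= [X in _ + X]big1 ?addn0 => [|y /negPf->] //.
    by rewrite !inE eqxx andbC; case: ifP => _; lia.
  have : 0 < #|X| by apply/card_gt0P; exists e.
  have : 0 < #|~: X| by apply/card_gt0P; exists r; rewrite inE.
  by lia.
(* As N = n + m is even, half of d changes by |X| - N/2. The term |X| cancels modulo 2 against the
   change in inversions and N/2 remains. *)
rewrite /word_parity; move: inv sep (odd_double_half (n + m)).
rewrite (negPf evN) add0n; set h := (n + m)./2; lia.
Qed.

(** The case C = B, where s is also a leaf at B. Two letters visited once are exchanged: the
    inversions change by one, and the separated pair (A, s) is traded for (s, A). *)
Lemma word_parity_leaf_sibling A B s t :
  let w1 := [:: B; A; B; s] ++ rcons t B in
  let w2 := [:: B; s; B; A] ++ rcons t B in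
  (forall x, x \in w1) -> A != B -> s != A -> s != B -> A \notin t -> s \notin t ->
  word_parity w1 != word_parity w2.
Proof.
move=> w1 w2 full neqAB neqsA neqsB At st.
have BsE : (B == s) = false by rewrite eq_sym (negPf neqsB).
have BAE : (B == A) = false by rewrite eq_sym (negPf neqAB).
have AsE : (A == s) = false by rewrite eq_sym (negPf neqsA).
have i1 x : index x w1 = if x == B then 0 else if x == A then 1 else if x == s then 3
                         else 4 + index x (rcons t B).
  by rewrite /w1 /= !(eq_sym _ x); do !case: ifP.
have i2 x : index x w2 = if x == B then 0 else if x == s then 1 else if x == A then 3
                         else 4 + index x (rcons t B).
  by rewrite /w2 /= !(eq_sym _ x); do !case: ifP.
have tA : (A \in rcons t B) = false by rewrite mem_rcons inE (negPf neqAB) (negPf At).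
have ts : (s \in rcons t B) = false by rewrite mem_rcons inE (negPf neqsB) (negPf st).
have tx x : x != A -> x != s -> x \in rcons t B.
  move=> xA xs; have := full x; rewrite mem_cat => /orP[|//].
  by rewrite !inE (negPf xA) (negPf xs) !orbF => /= /orP[]/eqP->; rewrite mem_rcons mem_head.
have full2 x : x \in w2.
  have := full x; rewrite !mem_cat => /orP[|->]; last by rewrite orbT.
  by rewrite !inE => /or4P[]->; rewrite ?orbT.
have l1 x : lastpos w1 x = if x == A then 1 else if x == s then 3
                           else 4 + lastpos (rcons t B) x.
  rewrite /w1 lastpos_cat //; case: eqP => [->|/eqP xA].
    by rewrite tA /lastpos /rev /= ?BsE ?BAE ?(negPf neqsA) ?AsE ?(negPf neqCA) !eqxx.
  case: eqP => [->|/eqP xs]; first by rewrite ts /lastpos /rev /= eqxx.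
  by rewrite tx.
have l2 x : lastpos w2 x = if x == s then 1 else if x == A then 3
                           else 4 + lastpos (rcons t B) x.
  rewrite /w2 lastpos_cat //; case: eqP => [->|/eqP xs].
    by rewrite ts /lastpos /rev /= ?BsE ?BAE ?(negPf neqsA) ?AsE ?(negPf neqCA) !eqxx.
  case: eqP => [->|/eqP xA]; first by rewrite tA /lastpos /rev /= eqxx.
  by rewrite tx.
clearbody w1 w2.
have inv : odd (word_inv w2 + #|[set s]|) = odd (word_inv w1).
  apply: (@word_inv_jump _ _ A); first by rewrite !inE AsE.
  move=> x y; rewrite !i1 !i2 !inE.
  have [->|xB] := eqVneq x B; have [->|yB] := eqVneq y B; rewrite ?BAE ?BsE //.
    by do !case: eqP.
    by do !case: eqP.
  have [->|xA] := eqVneq x A; have [->|yA] := eqVneq y A; rewrite ?AsE ?(negPf neqsA) //.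
  - by case: (y == s).
  - by case: (x == s).
  - by case: (x == s); case: (y == s).
have sep : word_sep w2 = word_sep w1.
  have pair (a b : V n m) : \sum_x \sum_y ((x == a) && (y == b)) = 1.
    rewrite (bigD1 a) //= [X in _ + X]big1 ?addn0 => [|x /negPf->]; last by rewrite big1.
    by rewrite (bigD1 b) //= !eqxx big1 // => y /negPf->; rewrite andbF.
  (* The unit added beside w2 is the indicator of (A, s), which only w1 separates; the one beside w1
     is the indicator of (s, A), which only w2 separates. *)
  apply/eqP; rewrite -(eqn_add2r 1) -{1}(pair A s) -(pair s A); apply/eqP.
  rewrite /word_sep -!big_split; apply: eq_bigr => x _ /=.
  rewrite -!big_split; apply: eq_bigr => y _ /=.
  rewrite i1 i2 l1 l2.
  have [->|xA] := eqVneq x A; have [->|yA] := eqVneq y A; rewrite ?AsE ?(negPf neqsA) ?(negPf neqAB) //=.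
  - have [->|ys] := eqVneq y s; rewrite ?(negPf neqsB) //=.
    by case: ifP.
  - by case: (x == s).
  - have [xsE|xs] := eqVneq x s; have [ysE|ys] := eqVneq y s; rewrite ?xsE ?ysE ?(negPf neqsB) //=.
    by case: ifP.
rewrite cards1 in inv; rewrite /word_parity sep; exact: odd_jump1.
Qed.

(** The case C != B. Jumping over s and C keeps the parity of the inversions. Since B, s and C all
    recur in the tail, only the last visit of A moves; the separated pairs (A, s) and (A, C) vanish,
    and half of d drops by one. *)
Lemma word_parity_leaf_grandchild A B C s t :
  let w1 := [:: B; A; B; s] ++ C :: rcons t B in
  let w2 := [:: B; s; C; A] ++ C :: rcons t B in
  (forall x, x \in w1) -> A != B -> s != A -> s != B -> C != A -> C != B -> C != s ->
  A \notin t -> s \in t ->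
  word_parity w1 != word_parity w2.
Proof.
move=> w1 w2 full neqAB neqsA neqsB neqCA neqCB neqCs At st.
set t' := C :: rcons t B in w1 w2 full *.
have BsE : (B == s) = false by rewrite eq_sym (negPf neqsB).
have BAE : (B == A) = false by rewrite eq_sym (negPf neqAB).
have AsE : (A == s) = false by rewrite eq_sym (negPf neqsA).
have i1 x : index x w1 = if x == B then 0 else if x == A then 1 else if x == s then 3
                         else if x == C then 4 else 4 + index x t'.
  by rewrite /w1 /= !(eq_sym _ x); do !case: ifP.
have i2 x : index x w2 = if x == B then 0 else if x == s then 1 else if x == C then 2
                         else if x == A then 3 else 4 + index x t'.
  by rewrite /w2 /= !(eq_sym _ x); do !case: ifP.
have gt0 x : x != C -> 0 < index x t' by rewrite /t' /= eq_sym => /negPf->.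
have tA : (A \in t') = false.
  by rewrite inE mem_rcons inE eq_sym (negPf neqCA) (negPf neqAB) (negPf At).
have tx x : x != A -> x \in t'.
  move=> xA; have := full x; rewrite mem_cat => /orP[|//].
  have tB : B \in t' by rewrite inE mem_rcons mem_head orbT.
  have ts : s \in t' by rewrite inE mem_rcons inE st !orbT.
  by rewrite !inE => /or4P[]/eqP xE; rewrite ?xE // in xA *; rewrite eqxx in xA.
have full2 x : x \in w2.
  rewrite mem_cat; have [->|/tx->] := eqVneq x A; last by rewrite orbT.
  by rewrite !inE eqxx !orbT.
have l1 x : lastpos w1 x = if x == A then 1 else 4 + lastpos t' x.
  rewrite /w1 lastpos_cat //; case: eqP => [->|/eqP xA]; last by rewrite tx.
  by rewrite tA /lastpos /rev /= ?BsE ?BAE ?(negPf neqsA) ?AsE ?(negPf neqCA) !eqxx.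
have l2 x : lastpos w2 x = if x == A then 3 else 4 + lastpos t' x.
  rewrite /w2 lastpos_cat //; case: eqP => [->|/eqP xA]; last by rewrite tx.
  by rewrite tA /lastpos /rev /= eqxx.
(* The four named vertices are distinct; once their comparisons become free booleans, this bound
   discards the impossible cases. *)
have only x : (x == B) + (x == A) + (x == s) + (x == C) <= 1.
  have [->|xB] := eqVneq x B.
    by rewrite BAE BsE eq_sym (negPf neqCB).
  have [->|xA] := eqVneq x A; first by rewrite AsE eq_sym (negPf neqCA).
  have [->|xs] := eqVneq x s; first by rewrite eq_sym (negPf neqCs).
  by case: (x == C).
clearbody w1 w2 t'.
have cardY : #|[set s; C]| = 2 by rewrite cards2 eq_sym neqCs.
have inv : odd (word_inv w2 + #|[set s; C]|) = odd (word_inv w1).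
  apply: (@word_inv_jump _ _ A); first by rewrite !inE AsE eq_sym (negPf neqCA).
  move=> x y; rewrite !i1 !i2 !inE.
  have := gt0 x; have := gt0 y; have := only x; have := only y.
  move: (x == B) (x == A) (x == s) (x == C) => b1 b2 b3 b4.
  move: (y == B) (y == A) (y == s) (y == C) => c1 c2 c3 c4.
  move: (index x t') (index y t'); clear=> i j.
  case: c1; case: c2; case: c3; case: c4 => // _;
  case: b1; case: b2; case: b3; case: b4 => // _ /= gti gtj;
  by rewrite ?mul0n ?mul1n ?addn0 ?add0n //; lia.
have sep : word_sep w1 = word_sep w2 + 2.
  have <- : \sum_x \sum_y ((x == A) * (y \in [set s; C])) = 2.
    rewrite -cardY (bigD1 A) //= [X in _ + X]big1 ?addn0 => [|x /negPf->]; last by rewrite big1.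
    by rewrite -sum1_card [RHS]big_mkcond; apply: eq_bigr => y _; rewrite eqxx; case: ifP.
  rewrite /word_sep -!big_split; apply: eq_bigr => x _ /=.
  rewrite -!big_split; apply: eq_bigr => y _ /=.
  rewrite i1 i2 l1 l2 !inE; have := gt0 y.
  have := only y; move: (x == A) (y == B) (y == A) (y == s) (y == C) => b1 b2 b3 b4 b5.
  move: (index y t') (lastpos t' x); clear=> i j.
  by case: b1; case: b2; case: b3; case: b4; case: b5 => //=; lia.
rewrite cardY in inv; rewrite /word_parity sep addnAC; exact: odd_jump2.
Qed.

End Surgery.

(** * Edges of a tree separate it *)

(** A vertex set is grown one vertex at a time; each new vertex is joined to the old ones by an
    edge, which brings two new directed pairs. *)
Lemma connect_edge_bound (T : finType) (R : rel T) :
  symmetric R -> (forall x y, connect R x y) ->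
  (#|T| - 1).*2 <= #|[set p : T * T | R p.1 p.2]|.
Proof.
move=> symR conR.
case: (pickP T) => [x0 _|T0]; last by rewrite (eq_card0 T0).
suff grow k : k < #|T| -> exists2 S : {set T}, #|S| = k.+1 &
    k.*2 <= #|[set p : T * T | [&& R p.1 p.2, p.1 \in S & p.2 \in S]]|.
  have T_gt0 : 0 < #|T| by apply/card_gt0P; exists x0.
  have [|S _ leS] := grow (#|T| - 1); first by lia.
  apply: leq_trans leS _; apply: subset_leq_card; apply/subsetP => p.
  by rewrite !inE => /and3P[].
elim: k => [|k IHk] ltk; first by exists [set x0]; rewrite ?cards1.
have [S cardS leS] := IHk (ltnW ltk).
have [x xS] : exists x, x \in S by apply/card_gt0P; rewrite cardS.
have [y yS] : exists y, y \notin S.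
  have : 0 < #|~: S| by have := cardsC S; lia.
  by case/card_gt0P => y; rewrite inE; exists y.
(* If no edge left S, then S would be closed under [R], and connectivity would put y into S. *)
have [a [b [aS bS Rab]]] : exists a b, [/\ a \in S, b \notin S & R a b].
  case: (boolP [exists a, exists b, [&& a \in S, b \notin S & R a b]]).
    by case/existsP=> a /existsP[b /and3P[]]; exists a, b.
  move=> noedge; suff : y \in S by rewrite (negPf yS).
  have step a b : R a b -> a \in S -> b \in S.
    move=> Rab aS; apply: contraNT noedge => bS.
    by apply/existsP; exists a; apply/existsP; exists b; apply/and3P.
  suff clS : closed R (mem S) by rewrite -(closed_connect clS (conR x y)).
  by move=> a b Rab; apply/idP/idP; apply: step; rewrite // symR.
exists (b |: S); first by rewrite cardsU1 bS cardS.
have neq_ab : a != b by apply: contraNneq bS => <-.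
apply: (@leq_trans #|(a, b) |: ((b, a) |:
    [set p : T * T | [&& R p.1 p.2, p.1 \in S & p.2 \in S]])|).
  set E := [set p | _] in leS *.
  have aE : (a, b) \notin (b, a) |: E by rewrite !inE xpair_eqE (negPf neq_ab) (negPf bS) !andbF.
  have bE : (b, a) \notin E by rewrite inE /= (negPf bS) andbF.
  by rewrite !cardsU1 aE bE doubleS !add1n.
apply: subset_leq_card; apply/subsetP => p; rewrite !inE.
case/or3P => [/eqP->|/eqP->|/and3P[-> -> ->]] /=; rewrite ?eqxx ?aS ?Rab ?orbT //.
by rewrite symR Rab.
Qed.

Section PlaneTree.
Variables (n m : nat) (rs : V n m -> seq (V n m)).
Hypothesis tree : is_plane_tree rs.
Implicit Types (x y r e : V n m) (d : V n m * V n m).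

Let rs_uniq x : uniq (rs x). Proof. by case: tree. Qed.
Let rs_sym x y : (y \in rs x) = (x \in rs y). Proof. by case: tree. Qed.
Let rs_color x y : y \in rs x -> white x != white y. Proof. by case: tree => _ _ col _ _; apply: col. Qed.
Let rs_conn x y : connect (adj rs) x y. Proof. by case: tree. Qed.

Definition darts : {set V n m * V n m} := [set d | d.2 \in rs d.1].

Lemma card_V : #|V n m| = n + m.
Proof. by rewrite card_sum !card_ord. Qed.

Lemma card_darts : #|darts| = (n + m - 1).*2.
Proof.
case: tree => _ _ _ _ <-; rewrite -sum1_card.
rewrite (eq_bigl (fun d => true && (d.2 \in rs d.1))); last by move=> d; rewrite inE.
rewrite -(pair_big_dep xpredT (fun x y => y \in rs x) (fun _ _ => 1)) /=.
by apply: eq_bigr => x _; rewrite sum1_card; apply/card_uniqP.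
Qed.

(** X is the component of e once the edge is deleted. If it contained r, the remaining graph would
    still be connected, with fewer directed edges than [connect_edge_bound] demands. *)
Lemma edge_cut r e : e \in rs r ->
  exists X : {set V n m}, [/\ e \in X, r \notin X &
    forall x y, y \in rs x -> (x, y) != (r, e) -> (x, y) != (e, r) ->
      (x \in X) = (y \in X)].
Proof.
move=> er.
pose R : rel (V n m) := fun x y => [&& y \in rs x, (x, y) != (r, e) & (x, y) != (e, r)].
have symR : symmetric R.
  by move=> x y; rewrite /R rs_sym !xpair_eqE andbC [in RHS]andbC; congr (_ && _);
     rewrite andbC ![(y == _) && _]andbC.
have cR := sym_connect_sym symR.
exists [set x | connect R e x]; split; first by rewrite inE connect0.
  rewrite inE; apply/negP => er_conn.
  have conR x y : connect R x y.
    apply: (connect_sub _ (rs_conn x y)) => a b ab.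
    case: (eqVneq (a, b) (r, e)) => [[-> ->]|n1]; first by rewrite cR.
    case: (eqVneq (a, b) (e, r)) => [[-> ->] //|n2].
    by apply: connect1; apply/and3P.
  have := connect_edge_bound symR conR; rewrite card_V -card_darts.
  have neq_re : r != e by apply: contraTneq (rs_color er) => ->; rewrite eqxx.
  apply/negP; rewrite -ltnNge; apply: proper_card; apply/properP; split.
    by apply/subsetP => d; rewrite !inE => /and3P[].
  by exists (r, e); rewrite inE //= /R eqxx andbF.
move=> x y yx n1 n2; rewrite !inE; apply/idP/idP => ex; apply: connect_trans ex _; apply: connect1.
  by apply/and3P.
by rewrite symR; apply/and3P.
Qed.

(** * The contour walk is a single cycle *)

Lemma cstep_dart d : d \in darts -> cstep rs d \in darts.
Proof. by rewrite !inE /= mem_next rs_sym. Qed.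

(* [cstep] only permutes the darts; extended by the identity it is injective. *)
Definition dart_step d := if d \in darts then cstep rs d else d.

Lemma dart_step_inj : injective dart_step.
Proof.
move=> [x y] [x' y']; rewrite /dart_step.
case: ifP => d1; case: ifP => d2 //.
- case=> eqy; subst y'; move=> eqn; congr (_, _).
  by apply: (can_inj (prev_next (rs_uniq y))).
- by move=> E; rewrite -E cstep_dart in d2.
- by move=> E; rewrite E cstep_dart in d1.
Qed.

Lemma iter_dart k d : d \in darts -> iter k (cstep rs) d \in darts.
Proof. by move=> dd; elim: k => //= k; apply: cstep_dart. Qed.

Lemma iter_dart_step k d : d \in darts -> iter k dart_step d = iter k (cstep rs) d.
Proof. by move=> dd; elim: k => //= k ->; rewrite /dart_step iter_dart. Qed.

(** The walk enters X through (r, e), and (e, r) is the only dart leaving X. If (e, r) were never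
    met, every later head would lie in X, yet the walk is periodic and comes back to r. *)
Lemma fconnect_rev r e : e \in rs r -> fconnect dart_step (r, e) (e, r).
Proof.
move=> er; have [X [eX rX cutX]] := edge_cut er.
have dd : (r, e) \in darts by rewrite inE.
apply: contraT => nofc.
have inX k : (iter k (cstep rs) (r, e)).2 \in X.
  elim: k => [//|k IHk]; set d := iter k.+1 (cstep rs) (r, e).
  have d1 : d.1 \in X by [].
  have ddart : d.2 \in rs d.1 by have := iter_dart k.+1 dd; rewrite inE.
  rewrite -(cutX d.1) // -surjective_pairing.
    by apply: contraTneq d1 => ->.
  apply: contraNneq nofc => dE; rewrite -dE /d -iter_dart_step //.
  exact: fconnect_iter.
have := inX (order dart_step (r, e)).-1.
have := iter_order dart_step_inj (r, e).
rewrite -(ltn_predK (order_gt0 dart_step (r, e))) /= iter_dart_step //.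
by rewrite /dart_step iter_dart // => -[-> _]; rewrite (negPf rX).
Qed.

(** Reversing (x, y) and then stepping gives the next dart out of x, so all darts out of one vertex
    share a cycle. Reversal also links the two ends of an edge, and connectedness does the rest. *)
Lemma fconnect_darts d d' : d \in darts -> d' \in darts -> fconnect dart_step d d'.
Proof.
have csym := fconnect_sym dart_step_inj.
have turn x y : y \in rs x -> fconnect dart_step (x, y) (x, next (rs x) y).
  move=> yx; apply: connect_trans (fconnect_rev yx) _.
  have -> : (x, next (rs x) y) = dart_step (y, x) by rewrite /dart_step inE /= -rs_sym yx.
  exact: fconnect1.
have star x y z : y \in rs x -> z \in rs x -> fconnect dart_step (x, y) (x, z).
  move=> yx zx.
  have turns k : iter k (next (rs x)) y \in rs x /\
                 fconnect dart_step (x, y) (x, iter k (next (rs x)) y).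
    elim: k => [|k [IH1 IH2]] /=; first by rewrite connect0.
    by rewrite mem_next; split=> //; apply: connect_trans IH2 (turn _ _ _).
  have /iter_findex <- : fconnect (next (rs x)) y z.
    by rewrite (fconnect_cycle (cycle_next (rs_uniq x)) yx).
  by have [] := turns (findex (next (rs x)) y z).
case: d d' => [x y] [x' y']; rewrite !inE /= => yx y'x'.
have /connectP[p] := rs_conn x x'.
elim: p x y yx => [|z p IHp] x y yx /= => [_ eqx | /andP[zx pathp] eqx].
  by subst x'; apply: star.
apply: connect_trans (star _ _ _ yx zx) _; apply: connect_trans (fconnect_rev zx) _.
by apply: IHp pathp eqx; rewrite -rs_sym.
Qed.

Lemma order_darts d : d \in darts -> order dart_step d = (n + m - 1).*2.
Proof.
move=> dd; rewrite -card_darts; apply: eq_card => d'.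
apply/idP/idP => [/iter_findex <-|]; last exact: fconnect_darts.
by rewrite iter_dart_step // iter_dart.
Qed.

Lemma iter_darts_period d : d \in darts -> iter (n + m - 1).*2 (cstep rs) d = d.
Proof.
by move=> dd; rewrite -(order_darts dd) -iter_dart_step // iter_order //; apply: dart_step_inj.
Qed.

Definition walk d : seq (V n m * V n m) := traject (cstep rs) d (n + m - 1).*2.

Lemma walk_orbit d : d \in darts -> walk d = orbit dart_step d.
Proof.
move=> dd; rewrite /walk /orbit order_darts //.
apply: (@eq_from_nth _ d); rewrite !size_traject // => i lti.
by rewrite !nth_traject // iter_dart_step.
Qed.

Lemma walk_uniq d : d \in darts -> uniq (walk d).
Proof. by move=> dd; rewrite walk_orbit // orbit_uniq. Qed.

Lemma mem_walk d d' : d \in darts -> (d' \in walk d) = (d' \in darts).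
Proof.
move=> dd; rewrite walk_orbit // -fconnect_orbit; apply/idP/idP => [/iter_findex <-|].
  by rewrite iter_dart_step // iter_dart.
exact: fconnect_darts.
Qed.

Lemma contour_walk r e : (r, e) \in darts ->
  contour rs r e = rcons [seq d.1 | d <- walk (r, e)] r.
Proof.
move=> dd.
have -> : contour rs r e = [seq d.1 | d <- traject (cstep rs) (r, e) (n + m - 1).*2.+1].
  apply: (@eq_from_nth _ r); rewrite !size_map size_iota ?size_traject // => i lti.
  by rewrite !(nth_map (r, e), nth_map 0) ?size_iota ?size_traject // nth_iota // nth_traject.
by rewrite trajectSr map_rcons iter_darts_period.
Qed.

Lemma contour_full r e : (r, e) \in darts -> forall x, x \in contour rs r e.
Proof.
move=> dd x; rewrite contour_walk // mem_rcons inE.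
have [//|neq_xr] := eqVneq x r.
have /connectP[[|y p] /= pathp xr] := rs_conn x r; first by rewrite xr eqxx in neq_xr.
apply/mapP; exists (x, y) => //; rewrite mem_walk // inE /=.
by case/andP: pathp.
Qed.

Lemma iT_contour r e : (r, e) \in darts -> iT rs r e = word_parity (contour rs r e).
Proof. by move=> dd; apply: iT_word_parity; apply: contour_full. Qed.

End PlaneTree.

(** * Independence of the root *)

Section RootChange.
Variables (n m : nat) (rs : V n m -> seq (V n m)).
Hypothesis tree : is_plane_tree rs.
Implicit Types (x y r e : V n m) (d q : V n m * V n m).

(** Here [Z] is one side of an edge and [q] the only dart leaving that side: a walk avoiding [q]
    cannot cross. It is applied to both sides of the root edge. *)
Lemma fpath_trapped (Z : pred (V n m)) q d p :
  (forall d', d' \in darts rs -> d' != q -> Z d'.1 -> Z d'.2) ->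
  d \in darts rs -> Z d.2 -> fpath (cstep rs) d p -> q \notin p ->
  {in p, forall d', Z d'.1}.
Proof.
move=> trap; elim: p d => [//|d1 p IHp] d dd Zd /= /andP[/eqP fd pathp].
rewrite inE negb_or => /andP[neq_q qp] d'.
have dd1 : d1 \in darts rs by rewrite -fd cstep_dart.
have Zd1 : Z d1.1 by rewrite -fd.
rewrite inE => /orP[/eqP->//|]; apply: (IHp d1) => //.
by apply: trap; rewrite // eq_sym.
Qed.

(** The return dart (e, r) splits the contour word into the root r, a stretch inside the branch
    beyond the root edge, and a stretch outside it. Rerooting drops the leading r and appends e, as
    in [word_parity_shift]. *)
Lemma word_parity_cstep d : ~~ odd (n + m) -> d \in darts rs ->
  word_parity (contour rs (cstep rs d).1 (cstep rs d).2) =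
  word_parity (contour rs d.1 d.2) (+) odd (n + m)./2.
Proof.
case: d => r e evN dd; have dfd := cstep_dart tree dd.
have er : e \in rs r by rewrite inE in dd.
have re : r \in rs e by case: tree => _ <-.
have neq_re : r != e by case: tree => _ _ col _ _; apply: contraTneq (col _ _ er) => ->; rewrite eqxx.
have rev_d : (e, r) \in darts rs by rewrite inE.
have M_gt0 : 0 < (n + m - 1).*2 by rewrite -(card_darts tree); apply/card_gt0P; exists (r, e).
set k := ((n + m - 1).*2).-1; have Mk : (n + m - 1).*2 = k.+1 by rewrite prednK.
pose tl := traject (cstep rs) (cstep rs (r, e)) k.
have walkE : walk rs (r, e) = (r, e) :: tl by rewrite /walk Mk.
have walkE' : walk rs (cstep rs (r, e)) = rcons tl (r, e).
  by rewrite /walk Mk trajectSr -iterSr -Mk (iter_darts_period tree dd).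
have tl_path : fpath (cstep rs) (r, e) tl by apply: fpath_traject.
have tl_uniq := walk_uniq tree dd; rewrite walkE /= in tl_uniq; case/andP: tl_uniq => dtl tl_uniq.
have : (e, r) \in tl.
  have := mem_walk tree (e, r) dd; rewrite rev_d walkE inE xpair_eqE.
  by rewrite eq_sym (negPf neq_re).
have [X [eX rX cutX]] := edge_cut tree er.
have full := contour_full tree dd.
rewrite !contour_walk // walkE in full *; rewrite walkE' => /splitPr tlE.
case: tlE full tl_path tl_uniq dtl => p1 p2 full.
rewrite cat_path /= cat_uniq mem_cat inE !negb_or.
move=> /and3P[path1 /eqP last1 path2] /and3P[_ /andP[p1e _] _] /and3P[_ _ dp2].
set t1' := [seq d.1 | d <- rcons p1 (e, r)]; set t2' := rcons [seq d.1 | d <- p2] r.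
(* The stretch starts at e: either [p1] begins with the successor of (r, e), or it is empty and (e,
   r) comes first. *)
have [t1 t1E] : exists t1, t1' = e :: t1.
  rewrite /t1'; case: p1 path1 {full last1 p1e t1'} => [|d1 p1] /=; first by exists [::].
  by case/andP => /eqP <- _; exists [seq d.1 | d <- rcons p1 (e, r)].
have [t2 t2E] : exists t2, t2' = r :: t2.
  rewrite /t2'; case: p2 path2 {full dp2 t2'} => [|d2 p2] /=; first by exists [::].
  by case/andP => /eqP <- _; exists (rcons [seq d.1 | d <- p2] r).
have wE : [seq d.1 | d <- p1 ++ (e, r) :: p2] = [seq d.1 | d <- rcons p1 (e, r)] ++ [seq d.1 | d <- p2].
  by rewrite -map_cat cat_rcons.
have E1 : r :: rcons [seq d.1 | d <- p1 ++ (e, r) :: p2] r = r :: e :: t1 ++ r :: t2.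
  by rewrite /= wE rcons_cat -/t1' -/t2' t1E t2E.
have E2 : rcons [seq d.1 | d <- rcons (p1 ++ (e, r) :: p2) (r, e)] e = rcons (e :: t1 ++ r :: t2) e.
  by rewrite map_rcons wE rcons_cat -/t1' -/t2' t1E t2E.
rewrite /= E1 in full *; rewrite E2.
apply: (word_parity_shift (X := X)) => //.
- by rewrite -[last r t2]/(last r (r :: t2)) -t2E last_rcons.
- by rewrite -[last e t1]/(last e (e :: t1)) -t1E /t1' map_rcons last_rcons.
- move=> x; rewrite -t1E /t1' map_rcons mem_rcons inE => /orP[/eqP-> //|/mapP[d dp1 ->]].
  apply: (fpath_trapped (Z := mem X) (q := (e, r)) _ dd eX path1) => // d' dd' neq_q Xd'.
  rewrite /= -(cutX d'.1 d'.2) //; first by rewrite inE in dd'.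
  by apply: contraTneq Xd' => -[-> _].
move=> x; rewrite -t2E /t2' mem_rcons inE => /orP[/eqP-> //|/mapP[d dp2' ->]].
apply: (fpath_trapped (Z := [predC X]) (q := (r, e)) _ rev_d rX path2) => // d' dd' neq_q Xd'.
rewrite /= -(cutX d'.1 d'.2) //; first by rewrite inE in dd'.
by apply: contraNneq Xd' => -[-> _].
Qed.

(** Each step of the walk flips the colour of the root and changes the parity by N/2. The colour
    term compensates, and the single cycle reaches every dart. *)
Lemma word_parity_root d d' : ~~ odd (n + m) -> d \in darts rs -> d' \in darts rs ->
  word_parity (contour rs d.1 d.2) (+) (white d.1 && odd (n + m)./2) =
  word_parity (contour rs d'.1 d'.2) (+) (white d'.1 && odd (n + m)./2).
Proof.
move=> evN dd dd'; have /iter_findex <- := fconnect_darts tree dd dd'.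
rewrite iter_dart_step //; elim: (findex _ _ _) => //= k ->.
have := iter_dart tree k dd; set c := iter k _ d => dc.
rewrite word_parity_cstep //=.
have -> : white c.2 = ~~ white c.1.
  case: tree => _ _ col _ _; have := col c.1 c.2; rewrite inE in dc; move/(_ dc).
  by case: (white c.1); case: (white c.2).
by case: (white c.1); case: (odd _); case: word_parity.
Qed.

End RootChange.

(** * Moving a leaf *)

Lemma next_rem (T : eqType) (l : seq T) (a x : T) :
  uniq l -> a \in l -> x \in l -> x != a ->
  next (rem a l) x = if next l x == a then next l a else next l x.
Proof.
move=> Ul al; case/splitPr: al Ul => p1 p2 Ul xl neq_xa.
have ap1 : a \notin p1.
  by move: Ul; rewrite cat_uniq /= negb_or => /and3P[_ /andP[]].
have -> : rem a (p1 ++ a :: p2) = p1 ++ p2.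
  by elim: p1 ap1 {Ul xl} => [|b p1 IHp] /=; rewrite ?eqxx // inE negb_or eq_sym => /andP[/negPf-> /IHp->].
(* With a rotated to the front the list is a :: q; deleting a changes only the successor of the last
   entry of q, from a to the head of q. *)
rewrite -!(next_rot (size p1) Ul) rot_size_cat cat_cons.
have Uq : uniq (p2 ++ p1) by move: Ul; rewrite uniq_catC /= => /andP[].
rewrite -(next_rot (size p1)) ?rot_size_cat; last by rewrite uniq_catC.
have aq : a \notin p2 ++ p1 by move: Ul; rewrite uniq_catC /= => /andP[].
have xq : x \in p2 ++ p1.
  by move: xl; rewrite !mem_cat inE (negPf neq_xa) /= orbC.
move: (p2 ++ p1) Uq aq xq => q Uq aq xq.
rewrite !next_nth !inE !eqxx xq orbT /= eqxx (eq_sym a) (negPf neq_xa).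
case: q Uq aq xq => // y q Uq; rewrite inE negb_or => /andP[neq_ay aq] xq.
rewrite [nth a (y :: q) 0]/= [nth a (y :: q) _.+1]/=.
have [lt_q|le_q] := ltnP (index x (y :: q)) (size q).
  by rewrite (set_nth_default y) // ifN //; apply: contraNneq aq => <-; apply: mem_nth.
by rewrite !nth_default // eqxx.
Qed.

Lemma next_fixed (T : eqType) (l : seq T) (x y : T) :
  uniq l -> x \in l -> next l x = x -> y \in l -> y = x.
Proof.
move=> Ul xl nxt yl; case: (rot_to xl) => i l' rotE.
have Ur : uniq (x :: l') by rewrite -rotE rot_uniq.
move: yl nxt; rewrite -(mem_rot i) -(next_rot i Ul) rotE.
case: l' {rotE} Ur => [|z l'] /=; first by rewrite !inE => _ /eqP.
by rewrite eqxx inE => /andP[/norP[/eqP neq_xz _] _] _ zx; rewrite zx in neq_xz.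
Qed.

Section LeafSwap.
Variables (n m : nat).
Implicit Types (rs : V n m -> seq (V n m)) (A B C s x y : V n m) (d : V n m * V n m).

Lemma plane_tree_neq rs x y : is_plane_tree rs -> y \in rs x -> x != y.
Proof. by case=> _ _ col _ _ /col; apply: contraNneq => ->. Qed.

(** Away from the two darts of the leaf, and unless it is about to enter the leaf, the walk turns as
    if A were deleted. Walks of two trees that agree off A can thus be compared. *)
Lemma next_rem_away rs A B d : is_plane_tree rs -> rs A = [:: B] ->
  d \in darts rs -> d \notin [:: (A, B); (B, A)] -> cstep rs d != (B, A) ->
  next (rem A (rs d.2)) d.1 = next (rs d.2) d.1.
Proof.
case: d => x y [Urs sym _ _ _] rsA; rewrite !inE /= negb_or => yx /andP[nd1 nd2] nfd.
have AB z : (A \in rs z) = (z == B) by rewrite sym rsA inE.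
have [Ay|nAy] := boolP (A \in rs y); last by rewrite rem_id.
have /eqP yB : y == B by rewrite -AB.
have neq_xA : x != A by apply: contraNneq nd1 => ->; rewrite yB.
have xy : x \in rs y by rewrite -sym.
rewrite next_rem // ifN //; apply: contraNneq nfd.
by rewrite /cstep /= yB => ->.
Qed.

(** After their first four darts, around A, B, s and C, the two walks coincide. The hypotheses
    describe the corners of both trees rather than a given move, so either direction of movement can
    be fitted to them. *)
Lemma word_parity_leaf_swap rs1 rs2 A B C s :
  is_plane_tree rs1 -> is_plane_tree rs2 ->
  rs1 A = [:: B] -> rs2 A = [:: C] -> s != A ->
  next (rs1 B) A = s -> next (rs1 s) B = C -> next (rs2 C) s = A ->
  (forall x, x != A -> rem A (rs1 x) = rem A (rs2 x)) ->
  word_parity (contour rs1 B A) != word_parity (contour rs2 B s).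
Proof.
move=> tree1 tree2 rs1A rs2A neq_sA nextBA nextsB nextCs eq_rem.
have [U1 sym1 _ _ _] := tree1; have [U2 sym2 _ _ _] := tree2.
have AB z : (A \in rs1 z) = (z == B) by rewrite sym1 rs1A inE.
have AC z : (A \in rs2 z) = (z == C) by rewrite sym2 rs2A inE.
have A1B : A \in rs1 B by rewrite AB.
have A2C : A \in rs2 C by rewrite AC.
have s1B : s \in rs1 B by rewrite -nextBA mem_next.
have B1s : B \in rs1 s by rewrite sym1.
have C1s : C \in rs1 s by rewrite -nextsB mem_next.
have s1C : s \in rs1 C by rewrite sym1.
have neq_AB : A != B by rewrite eq_sym (plane_tree_neq tree1).
have neq_AC : A != C by rewrite eq_sym (plane_tree_neq tree2).
have neq_sB : s != B by rewrite (plane_tree_neq tree1).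
have neq_sC : s != C by rewrite (plane_tree_neq tree1).
have rs_s : rs2 s = rs1 s.
  by have := eq_rem s neq_sA; rewrite !rem_id ?AB ?AC.
have s2C : s \in rs2 C by rewrite sym2 rs_s.
have s2B : s \in rs2 B by rewrite sym2 rs_s.
have dBA1 : (B, A) \in darts rs1 by rewrite inE.
have dBs2 : (B, s) \in darts rs2 by rewrite inE.
(* Three distinct vertices A, B, s force at least four darts; K counts the darts of the common
   tail. *)
have [K MK] : exists K, (n + m - 1).*2 = K.+4.
  have : uniq [:: A; B; s] by rewrite /= !inE negb_or neq_AB eq_sym neq_sA eq_sym neq_sB.
  move/card_uniqP => card3; have := max_card (mem [:: A; B; s]).
  rewrite card3 card_V /= => N3; exists ((n + m - 1).*2 - 4).
  by move: (n + m) N3; clear=> N; lia.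
have f1BA : cstep rs1 (B, A) = (A, B) by rewrite /cstep /= rs1A /= eqxx.
have f1AB : cstep rs1 (A, B) = (B, s) by rewrite /cstep /= nextBA.
have f1Bs : cstep rs1 (B, s) = (s, C) by rewrite /cstep /= nextsB.
have f2Bs : cstep rs2 (B, s) = (s, C) by rewrite /cstep /= rs_s nextsB.
have f2sC : cstep rs2 (s, C) = (C, A) by rewrite /cstep /= nextCs.
have f2CA : cstep rs2 (C, A) = (A, C) by rewrite /cstep /= rs2A /= eqxx.
set D1 := traject (cstep rs1) (cstep rs1 (s, C)) K.
set D2 := traject (cstep rs2) (cstep rs2 (A, C)) K.
have walk1 : walk rs1 (B, A) = [:: (B, A); (A, B); (B, s); (s, C)] ++ D1.
  by rewrite /walk MK 4!trajectS f1BA f1AB f1Bs.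
have walk2 : walk rs2 (B, s) = [:: (B, s); (s, C); (C, A); (A, C)] ++ D2.
  by rewrite /walk MK 4!trajectS f2Bs f2sC f2CA.
have uniq1 := walk_uniq tree1 dBA1; have uniq2 := walk_uniq tree2 dBs2.
have mem1 d := mem_walk tree1 d dBA1; have mem2 d := mem_walk tree2 d dBs2.
rewrite walk1 walk2 in uniq1 uniq2 mem1 mem2; rewrite cat_uniq in uniq1; rewrite cat_uniq in uniq2.
case/and3P: uniq1 => _ dis1 _; case/and3P: uniq2 => _ dis2 _.
have out1 d : d \in D1 -> d \notin [:: (B, A); (A, B); (B, s); (s, C)].
  by move=> dD; apply: contra dis1 => d4; apply/hasP; exists d.
have out2 d : d \in D2 -> d \notin [:: (B, s); (s, C); (C, A); (A, C)].
  by move=> dD; apply: contra dis2 => d4; apply/hasP; exists d.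
have mem_traj f d i : i < K -> iter i f d \in traject f d K.
  by move=> ltiK; apply/trajectP; exists i.
have eqD : D1 = D2.
  apply: (@eq_from_nth _ (A, A)); rewrite !size_traject // => i ltiK.
  rewrite (set_nth_default (cstep rs1 (s, C))) ?size_traject // nth_traject //.
  rewrite (set_nth_default (cstep rs2 (A, C))) ?size_traject // nth_traject //.
  elim: i ltiK => [|i IHi] ltiK.
    (* The first walk leaves C by the successor of s, the second detours through A and leaves by the
       successor of A; deleting A identifies the two. *)
    have := out1 _ (mem_traj (cstep rs1) (cstep rs1 (s, C)) 0 ltiK).
    rewrite /= !inE => /norP[nBA _].
    rewrite /cstep /=; congr (_, _).
    have <- := @next_rem_away rs1 A B (s, C) tree1 rs1A.
    - by rewrite /= eq_rem 1?eq_sym // next_rem // nextCs eqxx.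
    - by rewrite inE.
    - by rewrite !inE !xpair_eqE (negPf neq_sA) (negPf neq_sB).
    - exact: nBA.
  have IH := IHi (ltnW ltiK).
  set d := iter i _ _ in IH.
  have d1 : d \in D1 by apply: mem_traj; apply: ltnW.
  have d2 : d \in D2 by rewrite IH; apply: mem_traj; apply: ltnW.
  have fd1 : cstep rs1 d \in D1 by apply: (mem_traj _ _ i.+1).
  have fd2 : cstep rs2 d \in D2 by rewrite IH; apply: (mem_traj _ _ i.+1).
  (* A dart ending at A is (B, A), which the first walk has already used. *)
  have dA : d.2 != A.
    have : d \in darts rs1 by rewrite -mem1 mem_cat d1 orbT.
    have := out1 _ d1; case: (d) => x y; rewrite !inE /= => /norP[nBA _] yx.
    by apply: contraNneq nBA => yA; rewrite yA AB in yx; rewrite yA (eqP yx).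
  rewrite !iterS -IH -/d /cstep; congr (_, _).
  rewrite -(@next_rem_away rs1 A B) //.
  - rewrite -(@next_rem_away rs2 A C) //.
    + by rewrite eq_rem.
    + by rewrite -mem2 mem_cat d2 orbT.
    + by have := out2 _ d2; rewrite !inE !negb_or => /and4P[_ _ -> ->].
    + by have := out2 _ fd2; rewrite !inE !negb_or => /and4P[].
  - by rewrite -mem1 mem_cat d1 orbT.
  - by have := out1 _ d1; rewrite !inE !negb_or => /and4P[-> ->].
  - by have := out1 _ fd1; rewrite !inE !negb_or => /and4P[].
rewrite !contour_walk // walk1 walk2 -eqD !map_cat !rcons_cat /=.
have full := contour_full tree1 dBA1; rewrite contour_walk // walk1 map_cat rcons_cat in full.
have AD : A \notin [seq d.1 | d <- D1].
  apply/mapP => -[[x y] dD /= xA]; subst x.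
  have : (A, y) \in darts rs1 by rewrite -mem1 mem_cat dD orbT.
  rewrite inE /= rs1A inE => /eqP yB; subst y.
  by have := out1 _ dD; rewrite !inE eqxx orbT.
(* If C = B, then B is its own successor around s, so s is a leaf and does not recur in the tail. *)
have [CB|neq_CB] := eqVneq C B.
  rewrite CB; apply: word_parity_leaf_sibling => //.
  apply/mapP => -[[x y] dD /= xs]; subst x.
  have : (s, y) \in darts rs1 by rewrite -mem1 mem_cat dD orbT.
  rewrite inE /= => ys.
  have yC : y = C by rewrite CB; apply: (next_fixed (U1 s) B1s) ys; rewrite nextsB.
  by have := out1 _ dD; rewrite yC !inE eqxx !orbT.
(* Otherwise (s, B) is not among the first four darts, so s is visited again in the tail; in
   particular K > 0, and the tail opens with a dart out of C. *)
have sB_D : (s, B) \in D1.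
  have : (s, B) \in darts rs1 by rewrite inE.
  rewrite -mem1 mem_cat !inE !xpair_eqE (negPf neq_sA) (negPf neq_sB) /=.
  by rewrite (eq_sym B C) (negPf neq_CB) andbF.
move: sB_D AD full; rewrite /D1; case: (K) => // K'.
rewrite trajectS map_cons rcons_cons.
set D := traject _ _ _; rewrite inE => /orP[/eqP[sC]|sB_D].
  by rewrite sC eqxx in neq_sC.
rewrite inE negb_or => /andP[_ AD] full.
apply: word_parity_leaf_grandchild => //; rewrite 1?eq_sym //.
by apply/mapP; exists (s, B).
Qed.

End LeafSwap.

Lemma next_neq (T : eqType) (l : seq T) (x : T) :
  uniq l -> x \in l -> 1 < size l -> next l x != x.
Proof.
move=> Ul xl; apply: contraTneq => nxt; rewrite -leqNgt.
have sub : {subset l <= [:: x]}.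
  by move=> y yl; rewrite inE (next_fixed Ul xl nxt yl).
exact: uniq_leq_size Ul sub.
Qed.

(** * Inserting an entry into a cyclic order *)

Section Insertion.
Variables (T : eqType) (s a : T) (c : seq T).
Hypotheses (Uc : uniq c) (sc : s \in c) (ac : a \notin c).

Lemma rem_insert k : rem a (take k c ++ a :: drop k c) = c.
Proof.
rewrite -[RHS](cat_take_drop k); have : a \notin take k c by apply: contra ac; apply: mem_take.
by elim: (take k c) => [|b l IHl] /=; rewrite ?eqxx // inE negb_or eq_sym => /andP[/negPf-> /IHl->].
Qed.

Lemma insert_uniq k : uniq (take k c ++ a :: drop k c).
Proof.
by rewrite -cat1s uniq_catCA cat1s cons_uniq cat_take_drop ac Uc.
Qed.

Lemma mem_insert k : a \in take k c ++ a :: drop k c.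
Proof. by rewrite mem_cat mem_head orbT. Qed.

Lemma next_insert_after : next (insert_after s a c) s = a.
Proof.
rewrite /insert_after; set k := index s c.
have ltk : k < size c by rewrite index_mem.
(* Rotated by k + 1 the list begins with a and ends with s, so the successor of s wraps around to
   a. *)
rewrite -(next_rot k.+1) ?insert_uniq // -{1}(size_takel ltk) rot_size_cat.
rewrite (take_nth s ltk) nth_index // cat_cons -rcons_cat.
have := insert_uniq k.+1; rewrite uniq_catC cat_cons (take_nth s ltk) nth_index // -rcons_cat cons_uniq.
move: (_ ++ _) => q /andP[aq]; rewrite rcons_uniq => /andP[sq _].
have neq_as : a != s by apply: contraNneq ac => ->.
rewrite next_nth !inE mem_rcons mem_head orbT /= (negPf neq_as).
by rewrite nth_default // -cats1 index_cat (negPf sq) size_cat /= eqxx addn0 addn1.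
Qed.

Lemma next_insert_before : next (insert_before s a c) a = s.
Proof.
rewrite /insert_before; set k := index s c.
have ltk : k < size c by rewrite index_mem.
rewrite -(next_rot k) ?insert_uniq // -{1}(size_takel (ltnW ltk)) rot_size_cat.
by rewrite (drop_nth s ltk) nth_index //= eqxx.
Qed.

End Insertion.

(** * Replanting a leaf and comparing invariants across two trees *)

Section Replant.
Variables (n m : nat).
Implicit Types (rs : V n m -> seq (V n m)) (A B C x y : V n m).

Lemma replant_plane_tree rs rs2 A B C :
  is_plane_tree rs -> rs A = [:: B] -> rs2 A = [:: C] -> C != A -> white C = white B ->
  (forall x, x != A -> rem A (rs2 x) = rem A (rs x)) ->
  (forall x, x != A -> (A \in rs2 x) = (x == C)) ->
  (forall x, uniq (rs2 x)) -> is_plane_tree rs2.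
Proof.
move=> tree rsA rs2A neq_CA colC eq_rem A2 U2.
have [U sym col conn szs] := tree.
have A1 x : (A \in rs x) = (x == B) by rewrite sym rsA inE.
have neq_BA : B != A by rewrite (plane_tree_neq tree) // A1.
have mem2 x y : x != A -> y != A -> (y \in rs2 x) = (y \in rs x).
  move=> xA yA; have := mem_rem_uniq A (U2 x) y; rewrite eq_rem // mem_rem_uniq //.
  by rewrite !inE yA.
have sym2 x y : (y \in rs2 x) = (x \in rs2 y).
  have [->|xA] := eqVneq x A; have [->|yA] := eqVneq y A => //.
  - by rewrite rs2A inE A2.
  - by rewrite rs2A inE A2.
  - by rewrite !mem2 // sym.
split=> //.
- move=> x y.
  have [->|xA] := eqVneq x A.
    by rewrite rs2A inE => /eqP->; rewrite colC; apply: col; rewrite rsA mem_head.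
  have [->|yA] := eqVneq y A; last by rewrite mem2 //; apply: col.
  by rewrite A2 // => /eqP->; rewrite colC; apply: col; rewrite A1.
- have csym : connect_sym (adj rs2) by apply: sym_connect_sym => x y; rewrite /adj sym2.
  (* Collapsing A onto its old neighbour B turns paths of [rs] into paths of [rs2] that avoid A. *)
  pose phi x := if x == A then B else x.
  have step x y : adj rs x y -> connect (adj rs2) (phi x) (phi y).
    rewrite /adj /phi => xy; have [xA|xA] := eqVneq x A; have [yA|yA] := eqVneq y A.
    + exact: connect0.
    + by move: xy; rewrite xA rsA inE => /eqP->.
    + by move: xy; rewrite yA A1 => /eqP->.
    + by apply: connect1; rewrite /adj mem2.
  have phi_conn x y : connect (adj rs2) (phi x) (phi y).
    have /connectP[p] := conn x y; elim: p x => [|z p IHp] x /= => [_ -> //|/andP[xz pz] yE].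
    exact: connect_trans (step _ _ xz) (IHp _ pz yE).
  have to_C x : connect (adj rs2) x C.
    have [->|xA] := eqVneq x A; first by apply: connect1; rewrite /adj rs2A mem_head.
    by have := phi_conn x C; rewrite /phi (negPf xA) (negPf neq_CA).
  by move=> x y; apply: connect_trans (to_C x) _; rewrite csym.
rewrite -szs; apply/eqP; rewrite -(eqn_add2r 1).
have one (z : V n m) : 1 = \sum_(x : V n m) (x == z).
  by rewrite (bigD1 z) //= eqxx big1 // => x /negPf->.
(* B loses a neighbour and C gains one; a unit placed at B on the left and at C on the right
   balances the degrees vertex by vertex. *)
rewrite {1}(one B) (one C) -!big_split /=; apply/eqP; apply: eq_bigr => x _.
have [->|xA] := eqVneq x A.
  by rewrite rsA rs2A (eq_sym A B) (eq_sym A C) (negPf neq_BA) (negPf neq_CA).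
have := congr1 size (eq_rem x xA).
have szrem (l : seq (V n m)) : size (rem A l) + (A \in l) = size l.
  have [Al|nAl] := boolP (A \in l); last by rewrite rem_id ?addn0.
  by rewrite size_rem //; case: (l) Al => //= *; rewrite addn1.
by rewrite -(szrem (rs2 x)) -(szrem (rs x)) A1 A2 // => ->; rewrite addnAC.
Qed.

(** One comparison at a common root b of either colour suffices: the correction in
    [word_parity_root] depends only on the colour of the root and on n + m, so it is the same in
    both trees. *)
Lemma iT_roots_differ rs rs2 b x y :
  ~~ odd (n + m) -> is_plane_tree rs -> is_plane_tree rs2 ->
  (b, x) \in darts rs -> (b, y) \in darts rs2 ->
  word_parity (contour rs b x) != word_parity (contour rs2 b y) ->
  forall r e r' e', valid_root rs r e -> valid_root rs2 r' e' -> iT rs2 r' e' != iT rs r e.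
Proof.
move=> evN tree tree2 dbx dby neq_bxy r e r' e' /andP[wr er] /andP[wr' er'].
have dre : (r, e) \in darts rs by rewrite inE.
have dre' : (r', e') \in darts rs2 by rewrite inE.
rewrite !iT_contour //.
have := word_parity_root tree evN dbx dre; have := word_parity_root tree2 evN dby dre'.
rewrite /= wr wr' /=; move: neq_bxy; case: (white b); case: (odd _); 
by do 4!case: (word_parity _).
Qed.

Lemma remove_leafE rs A B x : is_plane_tree rs -> rs A = [:: B] -> x != A ->
  remove_leaf rs A x = rem A (rs x).
Proof.
move=> [_ sym _ _ _] rsA xA; rewrite /remove_leaf rsA /=.
by case: eqP => [->//|/eqP xB]; rewrite rem_id // sym rsA inE.
Qed.

Lemma iT_rot rs rs2 r e : (forall x, uniq (rs x)) ->
  (forall x, exists k, rs2 x = rot k (rs x)) -> iT rs2 r e = iT rs r e.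
Proof.
move=> U rots.
have cE d : cstep rs2 d = cstep rs d.
  by rewrite /cstep; have [k ->] := rots d.2; rewrite next_rot.
rewrite /iT /cstring.
suff -> : contour rs2 r e = contour rs r e by [].
by apply: eq_map => k; rewrite (eq_iter cE).
Qed.

(** * The two directions of movement *)

Section Moves.
Variables (rs : V n m -> seq (V n m)) (A : V n m).
Hypotheses (tree : is_plane_tree rs) (szA : size (rs A) = 1).
Hypothesis szB : 1 < size (rs (head A (rs A))).
Hypothesis evN : ~~ odd (n + m).

Let B := head A (rs A).
Let rsA : rs A = [:: B].
Proof. by rewrite /B; case: (rs A) szA => // x []. Qed.
Let U x : uniq (rs x). Proof. by case: tree. Qed.
Let sym x y : (y \in rs x) = (x \in rs y). Proof. by case: tree. Qed.
Let AB : A \in rs B. Proof. by rewrite sym rsA mem_head. Qed.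
Let A1 x : (A \in rs x) = (x == B). Proof. by rewrite sym rsA inE. Qed.

Let neq_BA : B != A. Proof. exact: plane_tree_neq AB. Qed.

Let two_steps x y : x \in rs B -> y \in rs x -> white y = white B /\ y != A.
Proof.
case: (tree) => _ _ col _ _ /col xB /col yx.
have yB : white y = white B by move: xB yx; do 3!case: (white _).
by split=> //; have := col _ _ AB; apply: contraTneq => <-; rewrite yB eqxx.
Qed.

(** The cut k is left free so that [insert_after] and [insert_before] are both instances. *)
Lemma replanted_tree (rs2 : V n m -> seq (V n m)) C k :
  C != A -> white C = white B ->
  (forall x, rs2 x = if x == A then [:: C]
     else if x == C then take k (remove_leaf rs A C) ++ A :: drop k (remove_leaf rs A C)
     else remove_leaf rs A x) ->
  is_plane_tree rs2 /\ forall x, x != A -> rem A (rs2 x) = rem A (rs x).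
Proof.
move=> CA colC rs2E.
have notin x : A \notin rem A (rs x) by rewrite mem_rem_uniqF.
have eq_rem x : x != A -> rem A (rs2 x) = rem A (rs x).
  move=> xA; rewrite rs2E (negPf xA) !(remove_leafE tree rsA) //.
  by case: eqP => [->|_]; [apply: rem_insert | apply: rem_id].
have rs2A : rs2 A = [:: C] by rewrite rs2E eqxx.
split=> //; apply: (replant_plane_tree tree rsA rs2A) => // [x xA|x].
  rewrite rs2E (negPf xA) !(remove_leafE tree rsA) //.
  by case: eqP => _; [rewrite mem_insert | rewrite (negPf (notin x))].
have [->|xA] := eqVneq x A; first by rewrite rs2A.
rewrite rs2E (negPf xA) !(remove_leafE tree rsA) //.
by case: eqP => _; [apply: insert_uniq|]; rewrite ?rem_uniq ?notin.
Qed.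

Lemma move_ccw_parity : is_plane_tree (move_ccw rs A) /\
  forall r e r' e', valid_root rs r e -> valid_root (move_ccw rs A) r' e' ->
    iT (move_ccw rs A) r' e' != iT rs r e.
Proof.
set rs2 := move_ccw rs A.
pose s := next (rs B) A; pose C := next (rs s) B.
have sB : s \in rs B by rewrite mem_next.
have Cs : C \in rs s by rewrite mem_next sym.
have [colC CA] := two_steps sB Cs.
have neq_sA : s != A by apply: next_neq.
have [tree2 eq_rem] : is_plane_tree rs2 /\ forall x, x != A -> rem A (rs2 x) = rem A (rs x).
  by apply: (replanted_tree (C := C) (k := (index s (remove_leaf rs A C)).+1)).
split=> //; apply: (@iT_roots_differ _ _ B A s) => //; rewrite ?inE //=.
  have [_ sym2 _ _ _] := tree2; rewrite sym2 /rs2 /move_ccw -/B -/s -/C (negPf neq_sA).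
  have neq_sC : s != C by apply: plane_tree_neq Cs.
  by rewrite (negPf neq_sC) (remove_leafE tree rsA) // mem_rem_uniq // !inE neq_BA -sym.
apply: (@word_parity_leaf_swap _ _ _ _ A B C s) => //.
- by rewrite /rs2 /move_ccw eqxx.
- rewrite /rs2 /move_ccw -/B -/s -/C (negPf CA) eqxx (remove_leafE tree rsA) //.
  apply: next_insert_after; rewrite ?rem_uniq ?mem_rem_uniqF //.
  by rewrite mem_rem_uniq // !inE neq_sA -sym.
- by move=> x xA; rewrite eq_rem.
Qed.

(** A clockwise move is undone by a counterclockwise one: from C, past p, back to B. So
    [word_parity_leaf_swap] applies with the trees exchanged and both walks rooted at C. *)
Lemma move_cw_parity : is_plane_tree (move_cw rs A) /\
  forall r e r' e', valid_root rs r e -> valid_root (move_cw rs A) r' e' ->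
    iT (move_cw rs A) r' e' != iT rs r e.
Proof.
set rs2 := move_cw rs A.
pose p := prev (rs B) A; pose C := prev (rs p) B.
have pB : p \in rs B by rewrite mem_prev.
have Cp : C \in rs p by rewrite mem_prev sym.
have [colC CA] := two_steps pB Cp.
have nextp : next (rs B) p = A by rewrite next_prev.
have nextC : next (rs p) C = B by rewrite next_prev.
have neq_pA : p != A.
  by have := next_neq (U B) pB szB; rewrite nextp eq_sym.
have neq_pC : p != C by apply: plane_tree_neq Cp.
have pC : p \in rs C by rewrite sym.
have [tree2 eq_rem] : is_plane_tree rs2 /\ forall x, x != A -> rem A (rs2 x) = rem A (rs x).
  by apply: (replanted_tree (C := C) (k := index p (remove_leaf rs A C))).
have rs2A : rs2 A = [:: C] by rewrite /rs2 /move_cw eqxx.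
have rs2p : rs2 p = rs p.
  rewrite /rs2 /move_cw -/B -/p -/C (negPf neq_pA) (negPf neq_pC) (remove_leafE tree rsA) //.
  by rewrite rem_id // A1 eq_sym (plane_tree_neq tree).
split=> //; apply: (@iT_roots_differ _ _ C p A) => //; rewrite ?inE //=.
  by have [_ sym2 _ _ _] := tree2; rewrite sym2 rs2A mem_head.
rewrite eq_sym; apply: (@word_parity_leaf_swap _ _ _ _ A C B p) => //; last by rewrite rs2p.
rewrite /rs2 /move_cw -/B -/p -/C (negPf CA) eqxx (remove_leafE tree rsA) //.
apply: next_insert_before; rewrite ?rem_uniq ?mem_rem_uniqF //.
by rewrite mem_rem_uniq // !inE neq_pA.
Qed.

End Moves.
End Replant.

Theorem mainTheorem4 (n m : nat) (rs rs' : V n m -> seq (V n m)) :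
  ~~ odd (n + m) ->
  is_plane_tree rs ->
  elementary_move rs rs' ->
  forall r e r' e' : V n m,
    valid_root rs r e -> valid_root rs' r' e' ->
    iT rs' r' e' != iT rs r e.
Proof.
move=> evN tree [A [szA szB mv]] r e r' e' root root'.
(* The moved tree is given only up to rotating each neighbour list, which changes neither [next] nor
   membership. *)
have transfer rs2 : (forall x, exists k, rs' x = rot k (rs2 x)) ->
    is_plane_tree rs2 /\ (forall r e r' e', valid_root rs r e -> valid_root rs2 r' e' ->
      iT rs2 r' e' != iT rs r e) -> iT rs' r' e' != iT rs r e.
  move=> rots [[U2 _ _ _ _] parity2]; rewrite (iT_rot _ _ U2 rots); apply: parity2 => //.
  by move: root'; rewrite /valid_root; have [k ->] := rots r'; rewrite mem_rot.
by case: mv => /transfer; apply; [apply: move_ccw_parity | apply: move_cw_parity].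
Qed.
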